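(* There exist no skew-symmetric association schemes with $4$ classes with either of the following parameters $(|X|,k,\lambda,\mu,r^{m_1},s^{m_2},\text{type})$: 1. $(889,\,222,\,35,\,62,\,5^{762},\,(-32)^{126},\,\text{II})$; 2. $(945,\,354,\,153,\,120,\,39^{118},\,(-6)^{826},\,\text{II})$.
   Context: A commutative association scheme with $n$ classes on a finite set $X$ is a set $\{R_0,\dots,R_n\}$ of non-empty subsets of $X\times X$ whose adjacency matrices $A_0,\dots,A_n$ satisfy: $A_0=I$; $\sum_i A_i=J$ (the all-ones matrix); for each $i$ there is $i'$ with $A_i^\top=A_{i'}$; $A_iA_j=\sum_k p_{i,j}^kA_k$ for non-negative integers $p_{i,j}^k$; and $A_iA_j=A_jA_i$ for all $i,j$. It is skew-symmetric if no relation other than the diagonal relation $R_0$ is symmetric. A skew-symmetric association scheme with $4$ classes has the form $(X,\{R_0,R_1,R_1^\top,R_2,R_2^\top\})$, and then $(X,\{R_0,R_1\cup R_1^\top,R_2\cup R_2^\top\})$ is a symmetric association scheme. Let $$\tilde P=\begin{pmatrix}1&k_1&k_2\\1&r&t\\1&s&u\end{pmatrix}$$ be the first eigenmatrix of this symmetric scheme (rows indexed by common eigenspaces, columns by the relations $R_0$, $R_1\cup R_1^\top$, $R_2\cup R_2^\top$, entries the corresponding eigenvalues of the adjacency matrices), with row multiplicities $1,m_1,m_2$. The parameters $(|X|,k,\lambda,\mu,r^{m_1},s^{m_2})$ mean that the graph $(X,R_1\cup R_1^\top)$ is strongly regular with $|X|$ vertices, valency $k=k_1$, each pair of adjacent vertices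 having $\lambda$ common neighbours and each pair of distinct non-adjacent vertices having $\mu$ common neighbours, and that its eigenvalues other than the valency are $r$ with multiplicity $m_1$ and $s$ with multiplicity $m_2$. With columns ordered as $R_0,R_1,R_2,R_2^\top,R_1^\top$ and a suitable ordering of the rows (common eigenspaces), the first eigenmatrix of the skew-symmetric scheme has the form $$P=\begin{pmatrix}1&k_1/2&k_2/2&k_2/2&k_1/2\\1&\rho&\tau&\bar\tau&\bar\rho\\1&\sigma&\omega&\bar\omega&\bar\sigma\\1&\bar\sigma&\bar\omega&\omega&\sigma\\1&\bar\rho&\bar\tau&\tau&\rho\end{pmatrix}$$ with multiplicities $1,m_1/2,m_2/2,m_2/2,m_1/2$. The scheme is of type II if $\rho=(r+\sqrt{-y})/2$, $\sigma=s/2$, $\tau=t/2$, $\omega=(u+\sqrt{-c})/2$, where $y=|X|k_1/m_1$ and $c=|X|k_2/m_2$. *)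

(* Defs.v *)
From HB Require Import structures.
From mathcomp Require Import all_boot all_order all_algebra.
Set Implicit Arguments.
Unset Strict Implicit.
Unset Printing Implicit Defensive.
Import Order.TTheory GRing.Theory Num.Theory.
Local Open Scope ring_scope.

Section Relations.
Variable X : finType.
Implicit Types S : {set X * X}.

Definition diag_rel : {set X * X} := [set p | p.1 == p.2].

Definition tr_rel S : {set X * X} := [set p | (p.2, p.1) \in S].

(* Rows and columns are indexed by X through its canonical enumeration. *)
Definition adjmx (F : nzRingType) S : 'M[F]_#|X| :=
  \matrix_(x, y) ((enum_val x, enum_val y) \in S)%:R.

Definition commutative_scheme (n : nat) (R : 'I_n.+1 -> {set X * X}) : Prop :=
  let A i := adjmx int (R i) in
  [/\ forall i, R i != set0,
      A ord0 = 1%:M /\ \sum_i A i = const_mx 1,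
      forall i, exists i', (A i)^T = A i',
      exists p : 'I_n.+1 -> 'I_n.+1 -> 'I_n.+1 -> nat,
        forall i j, A i *m A j = \sum_k (p i j k)%:R *: A k
    & forall i j, A i *m A j = A j *m A i].

Definition skew_symmetric (n : nat) (R : 'I_n.+1 -> {set X * X}) : Prop :=
  forall i, i != ord0 -> tr_rel (R i) != R i.

(* The relations in the order of the columns of the eigenmatrix [P_skew4]. *)
Definition skew4_rel (R1 R2 : {set X * X}) (i : 'I_5) : {set X * X} :=
  nth set0 [:: diag_rel; R1; R2; tr_rel R2; tr_rel R1] i.

Definition sym2_rel (R1 R2 : {set X * X}) (i : 'I_3) : {set X * X} :=
  nth set0 [:: diag_rel; R1 :|: tr_rel R1; R2 :|: tr_rel R2] i.

Definition strongly_regular S (v k lambda mu : nat) : Prop :=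
  let common x y := #|[set z | ((x, z) \in S) && ((y, z) \in S)]| in
  [/\ tr_rel S = S /\ (forall x, (x, x) \notin S),
      #|X| = v,
      forall x, #|[set y | (x, y) \in S]| = k,
      forall x y, (x, y) \in S -> common x y = lambda
    & forall x y, x != y -> (x, y) \notin S -> common x y = mu].

End Relations.

Section Eigenmatrices.
Variables (C : numClosedFieldType) (X : finType).

(* [eigenspace] consists of row vectors; the transpose makes its elements the *)
(* transposes of the column vectors w with A_i w = P_(j, i) w for all i.      *)
Definition common_eigenspace (n : nat) (R : 'I_n.+1 -> {set X * X})
    (P : 'M[C]_n.+1) (j : 'I_n.+1) : 'M[C]_#|X| :=
  (\bigcap_i eigenspace (adjmx C (R i))^T (P j i))%MS.

(* The first row corresponds to the span of the all-ones vector. *)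
Definition first_eigenmatrix (n : nat) (R : 'I_n.+1 -> {set X * X})
    (P : 'M[C]_n.+1) (m : 'I_n.+1 -> nat) : Prop :=
  let V := common_eigenspace R P in
  [/\ (V ord0 == (const_mx 1 : 'rV[C]_#|X|))%MS,
      forall j, (0 < m j)%N /\ \rank (V j) = m j,
      mxdirect (\sum_j V j)
    & row_full (\sum_j V j)%MS].

(* Eigenvalues k, r, s of a graph, the last two with their multiplicities. *)
Definition graph_spectrum (S : {set X * X}) (k r s : C) (m1 m2 : nat) : Prop :=
  let A := adjmx C S in
  [/\ forall a, a != k -> eigenvalue A a = (a \in [:: r; s]),
      \rank (eigenspace A r) = m1
    & \rank (eigenspace A s) = m2].

Definition P_sym2 (k1 k2 r t s u : C) : 'M[C]_3 :=
  \matrix_(i, j) nth 0 (nth [::]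
    [:: [:: 1; k1; k2];
        [:: 1; r;  t];
        [:: 1; s;  u]] i) j.

Definition P_skew4 (k1 k2 rho tau sigma omega : C) : 'M[C]_5 :=
  \matrix_(i, j) nth 0 (nth [::]
    [:: [:: 1; k1 / 2;   k2 / 2;   k2 / 2;   k1 / 2];
        [:: 1; rho;      tau;      tau^*;    rho^*];
        [:: 1; sigma;    omega;    omega^*;  sigma^*];
        [:: 1; sigma^*;  omega^*;  omega;    sigma];
        [:: 1; rho^*;    tau^*;    tau;      rho]] i) j.

(* For x > 0, sqrtC (- x) is the root with positive imaginary part. *)
Definition type_II (v m1 m2 k1 k2 r t s u rho tau sigma omega : C) : Prop :=
  let y := v * k1 / m1 in
  let c := v * k2 / m2 in
  [/\ rho = (r + sqrtC (- y)) / 2, sigma = s / 2,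
      tau = t / 2 & omega = (u + sqrtC (- c)) / 2].

(* The halving of m1 and m2 is exact: the multiplicities 1, m1, m2 of the    *)
(* first eigenmatrix and 1, m1./2, m2./2, m2./2, m1./2 of the second one     *)
(* both add up to #|X|.                                                      *)
Definition parameters_II (R1 R2 : {set X * X}) (v k lambda mu : nat)
    (r : int) (m1 : nat) (s : int) (m2 : nat) : Prop :=
  let Gamma := R1 :|: tr_rel R1 in
  let k1 : C := k%:R in
  let r' : C := r%:~R in
  let s' : C := s%:~R in
  [/\ strongly_regular Gamma v k lambda mu,
      graph_spectrum Gamma k1 r' s' m1 m2
    & exists k2 t u rho tau sigma omega : C,
      [/\ first_eigenmatrix (sym2_rel R1 R2) (P_sym2 k1 k2 r' t s' u)
            (fun i => nth 0%N [:: 1; m1; m2]%N i),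
          first_eigenmatrix (skew4_rel R1 R2)
            (P_skew4 k1 k2 rho tau sigma omega)
            (fun i => nth 0%N [:: 1; m1./2; m2./2; m2./2; m1./2]%N i)
        & type_II v%:R m1%:R m2%:R k1 k2 r' t s' u rho tau sigma omega]].

End Eigenmatrices.

(* Main.v *)
Require Import Defs.
From mathcomp Require Import all_boot all_order all_algebra.
From mathcomp Require Import ring.
Set Implicit Arguments.
Unset Strict Implicit.
Unset Printing Implicit Defensive.
Import Order.TTheory GRing.Theory Num.Theory.
Local Open Scope ring_scope.

(** Both parameter sets violate the Krein condition.

    Let E be the Hermitian idempotent projecting onto one of the common
    eigenspaces of the scheme.  By the Schur product theorem the entrywise cube
    of E is positive semidefinite, so the sum of its entries is nonnegative
    ([sum_mul3_idem_ge0], in the form needed here).  But E is a linear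
    combination of the adjacency matrices, so its entries, and how often each
    of them occurs, can be read off the first eigenmatrix: the sum of the cubes
    is a rational function of the parameters ([krein_condition]), equal up to a
    positive factor to the Krein parameter q_{jj}^{j'}, where j' is the
    eigenspace conjugate to that of E.

    For a scheme of type II the coefficients of E on the two relations of one
    of the symmetric pairs are conjugate and nonreal.  Write -c for the square
    of the irrationality in an eigenvalue (u + sqrt(-c)) / 2.  The sum of the
    cubes of the two conjugate eigenvalues is then (u^3 - 3 u c) / 4, which is
    negative when u is positive and c is greater than u^2 / 3.  In the first
    case (eigenvalues -32 and 31, multiplicity 126) the condition reads
    0 <= - 64643 / 333^2, by [krein_type_II_row2]; in the second case
    (eigenvalues 39 and -40, multiplicity 118) it reads 0 <= - 4725 / 59^2,
    by [krein_type_II_row1]. *)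

(** * Positivity for entrywise products of Hermitian idempotents *)

(** Since E(x,y) = sum_a E(x,a) conj(E(y,a)) and similarly for F and G, the sum
    of the entries of the entrywise product is the sum over a, b, c of the
    squared moduli of sum_x E(x,a) F(x,b) G(x,c). *)
Lemma sum_mul3_idem_ge0 (C : numClosedFieldType) (v : nat) (E F G : 'M[C]_v) :
    E *m E = E -> F *m F = F -> G *m G = G ->
    (forall x y, E y x = (E x y)^*) -> (forall x y, F y x = (F x y)^*) ->
    (forall x y, G y x = (G x y)^*) ->
  0 <= \sum_x \sum_y E x y * F x y * G x y.
Proof.
move=> EE FF GG hE hF hG.
have sq (M : 'M[C]_v) x y : M *m M = M -> (forall x y, M y x = (M x y)^*) ->
    M x y = \sum_a M x a * (M y a)^* :> C.
  by move=> MM hM; rewrite -{1}MM mxE; apply: eq_bigr => a _; rewrite -hM.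
pose T a b c := \sum_x E x a * F x b * G x c.
suff -> : \sum_x \sum_y E x y * F x y * G x y
          = \sum_a \sum_b \sum_c T a b c * (T a b c)^*.
  by do 3!(apply: sumr_ge0 => ? _); apply: mul_conjC_ge0.
pose U x y a b c := (E x a * F x b * G x c) * (E y a * F y b * G y c)^*.
transitivity (\sum_x \sum_y \sum_a \sum_b \sum_c U x y a b c).
  apply: eq_bigr => x _; apply: eq_bigr => y _.
  rewrite (sq E x y) // (sq F x y) // (sq G x y) // -mulrA mulr_suml.
  apply: eq_bigr => a _; rewrite mulr_suml mulr_sumr; apply: eq_bigr => b _.
  rewrite !mulr_sumr; apply: eq_bigr => c _; rewrite /U !rmorphM /=; ring.
transitivity (\sum_a \sum_b \sum_c \sum_x \sum_y U x y a b c).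
  under eq_bigr => x _ do rewrite exchange_big /=.
  rewrite exchange_big /=; apply: eq_bigr => a _.
  under eq_bigr => x _ do rewrite exchange_big /=.
  rewrite exchange_big /=; apply: eq_bigr => b _.
  under eq_bigr => x _ do rewrite exchange_big /=.
  by rewrite exchange_big.
apply: eq_bigr => a _; apply: eq_bigr => b _; apply: eq_bigr => c _.
rewrite /T rmorph_sum mulr_suml; apply: eq_bigr => x _.
by rewrite mulr_sumr.
Qed.

(** * The Krein condition for a scheme with a given first eigenmatrix *)

Section Scheme.
Variables (C : numClosedFieldType) (X : finType) (n : nat).
Variables (R : 'I_n.+1 -> {set X * X}) (P : 'M[C]_n.+1) (m : 'I_n.+1 -> nat).
Hypothesis sumA : \sum_i adjmx int (R i) = const_mx 1.
Hypothesis eigP : first_eigenmatrix R P m.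

Let A i : 'M[C]_#|X| := adjmx C (R i).
Let V := common_eigenspace R P.

Definition bose_mesner (a : 'I_n.+1 -> C) : 'M[C]_#|X| := \sum_i a i *: A i.

(** The relations partition the set of pairs: this is what the equality of the
    sum of the adjacency matrices with the all-ones matrix means. *)
Lemma rel_unique (x y : 'I_#|X|) :
  exists i, forall j, ((enum_val x, enum_val y) \in R j) = (j == i).
Proof.
have /(congr1 (fun M : 'M[int]_#|X| => M x y)) := sumA.
rewrite summxE mxE; under eq_bigr => i _ do rewrite mxE.
rewrite -natr_sum => /eqP; rewrite -[1]/(1%:R) eqr_nat => /eqP s1.
have /existsP[i Ri] : [exists i, (enum_val x, enum_val y) \in R i].
  apply: contraT => /existsPn nR; move: s1; rewrite big1 // => i _.
  by rewrite (negPf (nR i)).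
exists i => j; have [->//|neji] := eqVneq j i; apply/negP => Rj.
by move: s1; rewrite (bigD1 i) // (bigD1 j) //= Ri Rj.
Qed.

Lemma bose_mesnerE a (x y : 'I_#|X|) i :
  (enum_val x, enum_val y) \in R i -> bose_mesner a x y = a i.
Proof.
move=> Ri; have [k Rk] := rel_unique x y.
have ki : i = k by apply/eqP; rewrite -Rk.
rewrite summxE (bigD1 i) //= big1 => [|j /negPf ji]; rewrite !mxE Rk.
  by rewrite ki eqxx mulr1 addr0.
by rewrite -ki ji mulr0.
Qed.

Lemma bose_mesner_eigen a l :
  V l *m (bose_mesner a)^T = (\sum_i a i * P l i) *: V l.
Proof.
rewrite /bose_mesner linear_sum mulmx_sumr scaler_suml; apply: eq_bigr => i _.
rewrite linearZ -scalemxAr -scalerA; congr (_ *: _).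
by apply/eigenspaceP; apply: bigcapmx_inf (submx_refl _).
Qed.

(** A matrix of the Bose-Mesner algebra acts on each common eigenspace as a
    scalar, and these eigenspaces span; so it is idempotent as soon as all
    these scalars are 0 or 1. *)
Lemma bose_mesner_idem a :
    (forall l, exists b : bool, \sum_i a i * P l i = b%:R) ->
  bose_mesner a *m bose_mesner a = bose_mesner a.
Proof.
move=> h; set E := bose_mesner a; apply: trmx_inj; rewrite trmx_mul.
have [_ _ _ full] := eigP; apply/eqP; rewrite -subr_eq0; apply/eqP.
suff /sub_kermxP : (1%:M <= kermx (E^T *m E^T - E^T))%MS by rewrite mul1mx.
have /submx_trans : (1%:M <= \sum_j V j)%MS by rewrite sub1mx.
apply; apply/sumsmx_subP => l _; apply/sub_kermxP.
have [b Eb] := h l; have VE : V l *m E^T = b%:R *: V l.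
  by rewrite bose_mesner_eigen Eb.
rewrite mulmxBr mulmxA VE -scalemxAl VE scalerA -natrM mulnb andbb.
by rewrite subrr.
Qed.

Lemma bose_mesner_ones : bose_mesner (fun=> 1) = const_mx 1.
Proof.
apply/matrixP => x y; have [i Ri] := rel_unique x y.
by rewrite (@bose_mesnerE _ x y i) ?Ri // mxE.
Qed.

Lemma row_sum i x : \sum_y A i x y = P ord0 i.
Proof.
have [/andP[_ sub0] _ _ _] := eigP.
have /eigenspaceP :
    ((const_mx 1 : 'rV[C]_#|X|) <= eigenspace (A i)^T (P ord0 i))%MS.
  by apply: submx_trans sub0 _; apply: bigcapmx_inf (submx_refl _).
move/rowP/(_ x); rewrite !mxE mulr1 => <-.
by apply: eq_bigr => y _; rewrite !mxE mul1r.
Qed.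

Lemma eigen_row_sum0 : (0 < #|X|)%N -> \sum_i P ord0 i = #|X|%:R.
Proof.
move=> X0; pose x := Ordinal X0.
under eq_bigr => i _ do rewrite -(row_sum i x).
rewrite exchange_big /= (_ : #|X|%:R = \sum_(y < #|X|) 1); last first.
  by rewrite sumr_const card_ord.
apply: eq_bigr => y _.
have /matrixP/(_ x y) := bose_mesner_ones; rewrite summxE mxE => <-.
by apply: eq_bigr => i _; rewrite scale1r.
Qed.

(** The all-ones matrix acts on the l-th eigenspace as the l-th row sum and
    maps everything into the span of the all-ones vector, which is the
    eigenspace of index 0 and is independent of the others. *)
Lemma eigen_row_sum l : l != ord0 -> \sum_i P l i = 0.
Proof.
move=> l0; have [/andP[_ sub0] rkV dirV _] := eigP.
apply/eqP/negPn/negP => nz.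
have VJ : V l *m const_mx 1 = (\sum_i P l i) *: V l.
  rewrite -[const_mx 1]trmxK trmx_const -bose_mesner_ones bose_mesner_eigen.
  by under eq_bigr => i _ do rewrite mul1r.
have subV : (V l <= V ord0)%MS.
  apply: submx_trans sub0; rewrite -(eqmx_scale _ nz) -VJ.
  have -> : (const_mx 1 : 'M[C]_#|X|)
            = (const_mx 1 : 'cV_#|X|) *m (const_mx 1 : 'rV_#|X|).
    by apply/matrixP => x y; rewrite !mxE big_ord1 !mxE mulr1.
  by rewrite mulmxA submxMl.
have [mpos rk] := rkV l; move: mpos.
rewrite -rk lt0n mxrank_eq0 => /negP; apply.
have /mxdirect_sumsP/(_ l isT) dl := dirV.
rewrite -submx0 -[X in (_ <= X)%MS]dl sub_capmx submx_refl.
apply: submx_trans subV _; apply: sumsmx_sup (submx_refl _) => //.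
by rewrite eq_sym.
Qed.

(** The coefficient vectors a, b, c describe three Hermitian idempotents of the
    Bose-Mesner algebra.  On the relation of index i the entrywise product of
    the three is a_i b_i c_i, and that relation has P_{0,i} pairs in each row. *)
Lemma krein_condition (tr : 'I_n.+1 -> 'I_n.+1) (a b c : 'I_n.+1 -> C) :
    (0 < #|X|)%N -> (forall i, tr_rel (R i) = R (tr i)) ->
    (forall i, a (tr i) = (a i)^*) -> (forall i, b (tr i) = (b i)^*) ->
    (forall i, c (tr i) = (c i)^*) ->
    (forall l, exists e : bool, \sum_i a i * P l i = e%:R) ->
    (forall l, exists e : bool, \sum_i b i * P l i = e%:R) ->
    (forall l, exists e : bool, \sum_i c i * P l i = e%:R) ->
  0 <= \sum_i a i * b i * c i * P ord0 i.
Proof.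
move=> X0 trR ha hb hc /bose_mesner_idem Ea /bose_mesner_idem Eb.
move=> /bose_mesner_idem Ec.
have herm d : (forall i, d (tr i) = (d i)^*) ->
    forall x y, bose_mesner d y x = (bose_mesner d x y)^*.
  move=> hd x y; have [i Ri] := rel_unique x y.
  have Rxy : (enum_val x, enum_val y) \in R i by rewrite Ri.
  rewrite (bose_mesnerE d Rxy) -hd; apply: bose_mesnerE.
  by rewrite -trR inE.
have := sum_mul3_idem_ge0 Ea Eb Ec (herm _ ha) (herm _ hb) (herm _ hc).
suff -> : \sum_x \sum_y
      bose_mesner a x y * bose_mesner b x y * bose_mesner c x y
    = #|X|%:R * \sum_i a i * b i * c i * P ord0 i.
  by rewrite pmulr_rge0 // ltr0n.
rewrite (_ : #|X|%:R = \sum_(x < #|X|) 1); last by rewrite sumr_const card_ord.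
rewrite mulr_suml; apply: eq_bigr => x _; rewrite mul1r.
under [RHS]eq_bigr => i _ do rewrite -(row_sum i x) mulr_sumr.
rewrite exchange_big /=; apply: eq_bigr => y _.
have [i Ri] := rel_unique x y.
have Rxy : (enum_val x, enum_val y) \in R i by rewrite Ri.
rewrite !(bose_mesnerE _ Rxy) (bigD1 i) //= big1 => [|j /negPf ji].
  by rewrite addr0 mxE Rxy mulr1.
by rewrite mxE Ri ji mulr0.
Qed.
End Scheme.

(** * Skew-symmetric schemes with four classes *)

(** The square of w^* is the conjugate of - y, that is - y itself, so w^* is w
    or - w; a real w is excluded because its square is negative. *)
Lemma conj_sqrtCN (C : numClosedFieldType) (y : C) :
  0 < y -> (sqrtC (- y))^* = - sqrtC (- y).
Proof.
move=> y0; set w := sqrtC _; have w2 : w ^+ 2 = - y by apply: sqrtCK.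
have : (w^*) ^+ 2 == w ^+ 2.
  by rewrite -rmorphXn w2 rmorphN /= (CrealP _) ?gtr0_real.
rewrite eqf_sqr => /orP[/eqP/CrealP wR|/eqP//].
have : 0 <= w ^+ 2 by apply: real_exprn_even_ge0.
by rewrite w2 oppr_ge0 => /(lt_le_trans y0); rewrite ltxx.
Qed.

(** The opposite is taken in the integers modulo 5: it fixes the diagonal and
    exchanges 1 with 4 and 2 with 3. *)
Lemma tr_skew4_rel (X : finType) (R1 R2 : {set X * X}) i :
  tr_rel (skew4_rel R1 R2 i) = skew4_rel R1 R2 (- i).
Proof.
have trK S : tr_rel (tr_rel S) = S :> {set X * X}.
  by apply/setP => -[x y]; rewrite !inE.
case: i => [[|[|[|[|[|]]]]] ?] //; rewrite /skew4_rel /= ?trK //.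
by apply/setP => -[x y]; rewrite !inE eq_sym.
Qed.

Lemma sum_adjmx_sym2 (X : finType) (R1 R2 : {set X * X}) :
    \sum_i adjmx int (skew4_rel R1 R2 i) = const_mx 1 ->
  \sum_i adjmx int (sym2_rel R1 R2 i) = const_mx 1.
Proof.
move=> sumA; apply/matrixP => x y.
have [i Ri] := rel_unique sumA x y.
have := (Ri (inord 0), Ri (inord 1), Ri (inord 2), Ri (inord 3), Ri (inord 4)).
rewrite /skew4_rel !inordK //= -!val_eqE /= !inordK //.
move=> [[[[d0 d1] d2] d3] d4].
rewrite summxE !big_ord_recl big_ord0 !mxE /sym2_rel /= !in_setU d0 d1 d2 d3 d4.
by case: i {Ri d0 d1 d2 d3 d4} => [[|[|[|[|[|]]]]] ?].
Qed.

(** The eigenmatrix of the symmetric scheme has the unknown entries k2, t and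
    u; its row sums, |X| and 0, determine them from |X|, k, r and s. *)
Lemma type_II_eigenmatrix (C : numClosedFieldType) (X : finType)
    (R1 R2 : {set X * X}) (v k k2 lambda mu : nat) (r : int) (m1 : nat)
    (s : int) (m2 : nat) :
    commutative_scheme (skew4_rel R1 R2) ->
    parameters_II C R1 R2 v k lambda mu r m1 s m2 ->
    v = (k + k2).+1 -> (0 < k)%N -> (0 < k2)%N ->
  exists wr ws : C,
    [/\ wr^* = - wr /\ wr ^+ 2 = - (v%:R * k%:R / m1%:R),
        ws^* = - ws /\ ws ^+ 2 = - (v%:R * k2%:R / m2%:R)
      & first_eigenmatrix (skew4_rel R1 R2)
          (P_skew4 k%:R k2%:R ((r%:~R + wr) / 2) (- (1 + r%:~R) / 2)
             (s%:~R / 2) ((- (1 + s%:~R) + ws) / 2))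
          (fun i => nth 0%N [:: 1; m1./2; m2./2; m2./2; m1./2]%N i)].
Proof.
move=> [_ [_ /sum_adjmx_sym2 sumS] _ _ _] [[_ cardX _ _ _] _].
move=> [l2 [t [u [rho [tau [sigma [omega [eigS eigP tII]]]]]]]] Dv k0 k20.
have v_gt0 : (0 < v)%N by rewrite Dv.
have X0 : (0 < #|X|)%N by rewrite cardX.
have Dl2 : l2 = k2%:R.
  have := eigen_row_sum0 sumS eigS X0.
  rewrite !big_ord_recl big_ord0 !mxE /= cardX Dv -addn1 !natrD addr0.
  by rewrite addrC => /addIr/addrI.
have Dt : t = - (1 + r%:~R).
  have /(_ (inord 1)) := eigen_row_sum sumS eigS.
  rewrite -val_eqE !big_ord_recl big_ord0 !mxE /= inordK //= => /(_ isT) e.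
  by apply/eqP; rewrite -addr_eq0 -[X in _ == X]e; apply/eqP; ring.
have Du : u = - (1 + s%:~R).
  have /(_ (inord 2)) := eigen_row_sum sumS eigS.
  rewrite -val_eqE !big_ord_recl big_ord0 !mxE /= inordK //= => /(_ isT) e.
  by apply/eqP; rewrite -addr_eq0 -[X in _ == X]e; apply/eqP; ring.
have [_ m_gt0 _ _] := eigS.
have m1_gt0 : (0 < m1)%N by have := (m_gt0 (inord 1)).1; rewrite inordK.
have m2_gt0 : (0 < m2)%N by have := (m_gt0 (inord 2)).1; rewrite inordK.
move: tII eigP => [-> -> -> ->]; rewrite Dt Du Dl2 => eigP.
exists (sqrtC (- (v%:R * k%:R / m1%:R))).
exists (sqrtC (- (v%:R * k2%:R / m2%:R))).
split=> //; split; rewrite ?sqrtCK // conj_sqrtCN //.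
  by rewrite divr_gt0 ?mulr_gt0 ?ltr0n.
by rewrite divr_gt0 ?mulr_gt0 ?ltr0n.
Qed.

(** The idempotent has coefficients e, e a, e b, e b^*, e a^* on the five
    relations; theta gives its eigenvalue from the last four entries of a row
    of the eigenmatrix, and the five assumptions on theta run through these
    rows. *)
Lemma krein_skew4 (C : numClosedFieldType) (X : finType)
    (R1 R2 : {set X * X}) (k1 k2 rho tau sigma omega : C) (m : 'I_5 -> nat)
    (e a b : C) :
    (0 < #|X|)%N -> commutative_scheme (skew4_rel R1 R2) ->
    first_eigenmatrix (skew4_rel R1 R2)
      (P_skew4 k1 k2 rho tau sigma omega) m ->
    e^* = e ->
  let theta x x' y y' := e * (1 + (a * x + a^* * x') + (b * y + b^* * y')) in
  let is_bool z := exists f : bool, z = f%:R :> C in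
    is_bool (theta (k1 / 2) (k1 / 2) (k2 / 2) (k2 / 2)) ->
    is_bool (theta rho rho^* tau tau^*) ->
    is_bool (theta sigma sigma^* omega omega^*) ->
    is_bool (theta sigma^* sigma omega^* omega) ->
    is_bool (theta rho^* rho tau^* tau) ->
  0 <= e ^+ 3 * (1 + (a ^+ 3 + a^* ^+ 3) * (k1 / 2)
                   + (b ^+ 3 + b^* ^+ 3) * (k2 / 2)).
Proof.
move=> X0 [_ [_ sumA] _ _ _]; set P := P_skew4 _ _ _ _ _ _ => eigP ce.
move=> theta is_bool h0 h1 h2 h3 h4.
pose c (i : 'I_5) := e * nth 0 [:: 1; a; b; b^*; a^*] i.
have c_conj i : c (- i) = (c i)^*.
  rewrite /c rmorphM /= ce; congr (e * _).
  by case: i => [[|[|[|[|[|]]]]] ?] //=; rewrite ?rmorph1 ?conjCK.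
have idem l : is_bool (\sum_i c i * P l i).
  have -> : \sum_i c i * P l i
            = theta (P l 1) (P l (- 1)) (P l (1 + 1)) (P l (- (1 + 1))).
    rewrite !big_ord_recl big_ord0 !mxE /c /theta /=.
    case: l => [[|[|[|[|[|]]]]] ?] //=; ring.
  by case: l => [[|[|[|[|[|]]]]] ?] //; rewrite !mxE /=.
have := krein_condition sumA eigP X0 (@tr_skew4_rel _ _ _)
  c_conj c_conj c_conj idem idem idem.
rewrite !big_ord_recl big_ord0 !mxE /c /=.
congr (0 <= _); ring.
Qed.

(** * The Krein conditions of type II *)

Section TypeII.
Variables (C : numClosedFieldType) (X : finType) (R1 R2 : {set X * X}).
Variables (v k k2 lambda mu : nat) (r : int) (m1 : nat) (s : int) (m2 : nat).
Hypothesis schemeR : commutative_scheme (skew4_rel R1 R2).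
Hypothesis paramR : parameters_II C R1 R2 v k lambda mu r m1 s m2.
Hypotheses (Dv : v = (k + k2).+1) (k_gt0 : (0 < k)%N) (k2_gt0 : (0 < k2)%N).

Let v' : C := v%:R.
Let l1 : C := k%:R.
Let l2 : C := k2%:R.
Let n1 : C := m1%:R.
Let n2 : C := m2%:R.
Let r' : C := r%:~R.
Let s' : C := s%:~R.
Let t : C := - (1 + r').
Let u : C := - (1 + s').

Let conj_half (x w : C) :
  x^* = x -> w^* = - w -> ((x + w) / 2)^* = (x - w) / 2.
Proof. by move=> cx cw; rewrite fmorph_div rmorphD rmorph_nat /= cx cw. Qed.
Let conj_div (x y w : C) :
  x^* = x -> y^* = y -> w^* = - w -> ((x - w) / y)^* = (x + w) / y.
Proof. by move=> cx cy cw; rewrite fmorph_div rmorphB /= cx cy cw opprK. Qed.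
Let conj_div0 (x y : C) : x^* = x -> y^* = y -> (x / y)^* = x / y.
Proof. by move=> cx cy; rewrite fmorph_div /= cx cy. Qed.

Let cnat (n : nat) : (n%:R : C)^* = n%:R. Proof. exact: rmorph_nat. Qed.
Let cl1 : l1^* = l1. Proof. exact: cnat. Qed.
Let cl2 : l2^* = l2. Proof. exact: cnat. Qed.
Let cs : s'^* = s'. Proof. exact: rmorph_int. Qed.
Let cr : r'^* = r'. Proof. exact: rmorph_int. Qed.
Let cu : u^* = u. Proof. by rewrite rmorphN rmorphD rmorph1 /= cs. Qed.
Let ct : t^* = t. Proof. by rewrite rmorphN rmorphD rmorph1 /= cr. Qed.

Let v_gt0 : (0 < v)%N. Proof. by rewrite Dv. Qed.
Let X_gt0 : (0 < #|X|)%N.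
Proof. by have [[_ -> _ _ _] _ _] := paramR. Qed.
Let v_neq0 : v' != 0. Proof. by rewrite pnatr_eq0 -lt0n. Qed.
Let l1_neq0 : l1 != 0. Proof. by rewrite pnatr_eq0 -lt0n. Qed.
Let l2_neq0 : l2 != 0. Proof. by rewrite pnatr_eq0 -lt0n. Qed.

(** The projection onto the eigenspace V_j has coefficient
    m_j P_{j,i}^* / (|X| k_i) on the relation of index i; this yields the
    coefficients e, a and b used in the proof.  The two equations
    assumed are orthogonality relations of the symmetric scheme; they make the
    eigenvalues of the matrix with these coefficients equal to 0 or 1.  In the
    conclusion, v l1 / n1 is the number y whose negative has its square root in rho. *)
Lemma krein_type_II_row1 : (0 < m1)%N ->
    1 + r' * s' / l1 + t * u / l2 = 0 ->
    1 + r' ^+ 2 / l1 + t ^+ 2 / l2 = v' / n1 ->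
  0 <= 1 + (r' ^+ 3 - 3 * r' * (v' * l1 / n1)) / l1 ^+ 2 + t ^+ 3 / l2 ^+ 2.
Proof.
move=> m1_gt0 orth12 orth11.
have [w [z [[cw w2] [cz _] eigP]]] :=
  type_II_eigenmatrix schemeR paramR Dv k_gt0 k2_gt0.
move: eigP w2; rewrite -/l1 -/l2 -/r' -/s' -/t -/u -/v' -/n1 => eigP w2.
have n1_neq0 : n1 != 0 by rewrite pnatr_eq0 -lt0n.
pose e := n1 / (2 * v').
have ce : e^* = e by rewrite fmorph_div rmorphM !rmorph_nat.
have e3_gt0 : 0 < e ^+ 3 by rewrite exprn_gt0 // divr_gt0 ?mulr_gt0 ?ltr0n.
have := krein_skew4 (a := (r' - w) / l1) (b := t / l2) X_gt0 schemeR eigP ce.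
rewrite /= conj_div // !conj_half // !conj_div0 // pmulr_rge0 //.
have -> : 1 + (((r' - w) / l1) ^+ 3 + ((r' + w) / l1) ^+ 3) * (l1 / 2) +
    ((t / l2) ^+ 3 + (t / l2) ^+ 3) * (l2 / 2)
  = 1 + (r' ^+ 3 + 3 * r' * w ^+ 2) / l1 ^+ 2 + t ^+ 3 / l2 ^+ 2.
  by field; do ?[apply/andP; split].
rewrite w2 mulrN; apply;
  [exists false|exists true|exists false|exists false|exists false] => /=.
- by rewrite /t; field; do ?[apply/andP; split].
- transitivity (e * ((1 + r' ^+ 2 / l1 + t ^+ 2 / l2) - w ^+ 2 / l1)).
    by field; do ?[apply/andP; split].
  by rewrite orth11 w2 /e; field; do ?[apply/andP; split].
- by rewrite -[RHS](mulr0 e) -orth12; field; do ?[apply/andP; split].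
- by rewrite -[RHS](mulr0 e) -orth12; field; do ?[apply/andP; split].
- transitivity (e * ((1 + r' ^+ 2 / l1 + t ^+ 2 / l2) + w ^+ 2 / l1)).
    by field; do ?[apply/andP; split].
  by rewrite orth11 w2 /e; field; do ?[apply/andP; split].
Qed.

(** The same for the eigenspace of index 2: here omega is the nonreal
    eigenvalue and v l2 / n2 is the number c of the definition of type II. *)
Lemma krein_type_II_row2 : (0 < m2)%N ->
    1 + r' * s' / l1 + t * u / l2 = 0 ->
    1 + s' ^+ 2 / l1 + u ^+ 2 / l2 = v' / n2 ->
  0 <= 1 + s' ^+ 3 / l1 ^+ 2 + (u ^+ 3 - 3 * u * (v' * l2 / n2)) / l2 ^+ 2.
Proof.
move=> m2_gt0 orth12 orth22.
have [z [w [[cz _] [cw w2] eigP]]] :=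
  type_II_eigenmatrix schemeR paramR Dv k_gt0 k2_gt0.
move: eigP w2; rewrite -/l1 -/l2 -/r' -/s' -/t -/u -/v' -/n2 => eigP w2.
have n2_neq0 : n2 != 0 by rewrite pnatr_eq0 -lt0n.
pose e := n2 / (2 * v').
have ce : e^* = e by rewrite fmorph_div rmorphM !rmorph_nat.
have e3_gt0 : 0 < e ^+ 3 by rewrite exprn_gt0 // divr_gt0 ?mulr_gt0 ?ltr0n.
have := krein_skew4 (a := s' / l1) (b := (u - w) / l2) X_gt0 schemeR eigP ce.
rewrite /= conj_div // !conj_half // !conj_div0 // pmulr_rge0 //.
have -> : 1 + ((s' / l1) ^+ 3 + (s' / l1) ^+ 3) * (l1 / 2) +
    (((u - w) / l2) ^+ 3 + ((u + w) / l2) ^+ 3) * (l2 / 2)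
  = 1 + s' ^+ 3 / l1 ^+ 2 + (u ^+ 3 + 3 * u * w ^+ 2) / l2 ^+ 2.
  by field; do ?[apply/andP; split].
rewrite w2 mulrN; apply;
  [exists false|exists false|exists true|exists false|exists false] => /=.
- by rewrite /u; field; do ?[apply/andP; split].
- by rewrite -[RHS](mulr0 e) -orth12; field; do ?[apply/andP; split].
- transitivity (e * ((1 + s' ^+ 2 / l1 + u ^+ 2 / l2) - w ^+ 2 / l2)).
    by field; do ?[apply/andP; split].
  by rewrite orth22 w2 /e; field; do ?[apply/andP; split].
- transitivity (e * ((1 + s' ^+ 2 / l1 + u ^+ 2 / l2) + w ^+ 2 / l2)).
    by field; do ?[apply/andP; split].
  by rewrite orth22 w2 /e; field; do ?[apply/andP; split].
- by rewrite -[RHS](mulr0 e) -orth12; field; do ?[apply/andP; split].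
Qed.
End TypeII.

Theorem theorem5p1 (C : numClosedFieldType) :
  ~ (exists (X : finType) (R1 R2 : {set X * X}),
       [/\ commutative_scheme (skew4_rel R1 R2),
           skew_symmetric (skew4_rel R1 R2)
         & parameters_II C R1 R2 889 222 35 62 5 762 (- 32) 126]) /\
  ~ (exists (X : finType) (R1 R2 : {set X * X}),
       [/\ commutative_scheme (skew4_rel R1 R2),
           skew_symmetric (skew4_rel R1 R2)
         & parameters_II C R1 R2 945 354 153 120 39 118 (- 6) 826]).
Proof.
split=> -[X [R1 [R2 [sch _ par]]]].
- have := krein_type_II_row2 (k2 := 666) sch par erefl isT isT isT.
  rewrite [X in 0 <= X](_ : _ = - (127 * 509 / 333 ^+ 2)); last by field.
  rewrite oppr_ge0 lt_geF ?divr_gt0 ?mulr_gt0 ?exprn_gt0 ?ltr0n //.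
  by move=> h; suff: false by []; apply: h; field.
- have := krein_type_II_row1 (k2 := 590) sch par erefl isT isT isT.
  rewrite [X in 0 <= X](_ : _ = - (4725 / 59 ^+ 2)); last by field.
  rewrite oppr_ge0 lt_geF ?divr_gt0 ?exprn_gt0 ?ltr0n //.
  by move=> h; suff: false by []; apply: h; field.
Qed.
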